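(* Let $x\in\operatorname{dom}f$ and let $0<\varepsilon_t\le1$, $t\in T$, be such that $\inf_{t\in T}\varepsilon_tf_t(x)>-\infty$. Then for every $\varepsilon>0$, \[ \Big[\overline{\operatorname{co}}\Big(\bigcup_{t\in T}\partial_\varepsilon(\varepsilon_tf_t)(x)\Big)\Big]_\infty\subset \mathrm{N}_{\operatorname{dom}f}(x), \] and if in addition the standard hypothesis (SH) holds, then \[ \mathrm{N}_{\operatorname{dom}f}(x)=\Big[\overline{\operatorname{co}}\Big(\bigcup_{t\in T}\partial_\varepsilon(\varepsilon_tf_t)(x)\Big)\Big]_\infty . \]
   Context: $X$ is a real separated locally convex space with dual $X^*$ carrying the weak$^*$ topology (closures in $X^*$ are weak$^*$). $\Gamma_0(X)$ is the set of proper convex lsc functions $X\to\mathbb{R}\cup\{+\infty\}$. $T$ is a nonempty index set, $\{f_t: t\in T\}\subset\Gamma_0(X)$ and $f:=\sup_{t\in T}f_t$. For $g:X\to\overline{\mathbb{R}}$, $\partial_\varepsilon g(x)=\{x^*\in X^*:\ g(y)\ge g(x)+\langle x^*,y-x\rangle-\varepsilon\ \forall y\}$ if $g(x)\in\mathbb{R}$, $\varepsilon\ge0$ (empty otherwise). $\overline{\operatorname{co}}$ is the weak$^*$-closed convex hull; for a nonempty closed convex set $C$, $C_\infty:=\{y: z+\lambda y\in C$ for some $z\in C$ and all $\lambda\ge0\}$. The normal cone is $\mathrm{N}_A(x)=\{x^*:\langle x^*,y-x\rangle\le0\ \forall y\in A\}$ for $x\in A$. Standard hypothesis (SH): $T$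 is a compact Hausdorff topological space and for every $z\in X$ the map $t\mapsto f_t(z)$ is upper semicontinuous on $T$. *)

(* Defs.v *)
From HB Require Import structures.
From mathcomp Require Import all_boot all_order all_algebra.
From mathcomp Require Import all_classical all_reals all_analysis.
Set Implicit Arguments.
Unset Strict Implicit.
Unset Printing Implicit Defensive.
Import Order.TTheory GRing.Theory Num.Theory.
Import numFieldNormedType.Exports.
Local Open Scope classical_set_scope.
Local Open Scope ring_scope.

Section conjugate_analysis.
Context {R : realType} {X : tvsType R}.

Definition dual : set (X -> R) :=
  [set phi | (forall (a : R) (u v : X), phi (a *: u + v) = a * phi u + phi v)
             /\ continuous phi].

(* weak^star closure of A (a subset of X^star): closure in the topology of pointwise
   convergence on X (i.e. the weak^star topology sigma(X^star, X)), inside X^star. *)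
Definition wstar_closure (A : set (X -> R)) : set (X -> R) :=
  dual `&` @closure {ptws X -> R} A.

Definition wstar_closed (C : set (X -> R)) :=
  C `<=` dual /\ wstar_closure C `<=` C.

Definition dual_convex (C : set (X -> R)) :=
  forall phi psi (l : R), C phi -> C psi -> 0 <= l <= 1 ->
    C (fun v => l * phi v + (1 - l) * psi v).

Definition clco (A : set (X -> R)) : set (X -> R) :=
  [set phi | forall C, wstar_closed C -> dual_convex C -> A `<=` C -> C phi].

Definition recession (C : set (X -> R)) : set (X -> R) :=
  [set y | dual y /\
     exists2 z, C z & forall l : R, 0 <= l -> C (fun v => z v + l * y v)].

Definition normal_cone (A : set X) (x : X) : set (X -> R) :=
  [set phi | dual phi /\ forall y, A y -> phi (y - x) <= 0].

Local Open Scope ereal_scope.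

Definition edom (g : X -> \bar R) : set X := [set u | g u < +oo].

Definition proper_fun (g : X -> \bar R) :=
  (forall u, g u != -oo) /\ exists u, g u < +oo.

Definition convex_efun (g : X -> \bar R) :=
  forall (u v : X) (l : R), (0 <= l <= 1)%R ->
    g (l *: u + (1 - l) *: v)%R <= l%:E * g u + (1 - l)%:E * g v.

Definition Gamma0 (g : X -> \bar R) :=
  [/\ proper_fun g, convex_efun g & lower_semicontinuous g].

Definition eps_subdiff (e : R) (g : X -> \bar R) (x : X) : set (X -> R) :=
  [set phi | dual phi /\ g x \is a fin_num /\
     forall y, g x + (phi (y - x)%R)%:E - e%:E <= g y].

Definition supf {T : Type} (fam : T -> X -> \bar R) : X -> \bar R :=
  fun u => ereal_sup [set fam t u | t in [set: T]].

End conjugate_analysis.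

Definition upper_semicontinuous {T : topologicalType} {R : numFieldType}
  (g : T -> \bar R) := forall t (a : R), (g t < a%:E)%E ->
  exists2 V, nbhs t V & forall s, V s -> (g s < a%:E)%E.

Definition SH {R : realType} {X : tvsType R} {T : topologicalType}
  (fam : T -> X -> \bar R) :=
  [/\ compact [set: T], hausdorff_space T &
      forall z : X, upper_semicontinuous (fun t => fam t z)].

(* Main.v *)
Require Import Defs.
From HB Require Import structures.
From mathcomp Require Import all_boot all_order all_algebra.
From mathcomp Require Import all_classical all_reals all_analysis.
From mathcomp Require Import ring lra.

(** If [phi] is in the recession cone and [y] in [dom f], then the elements of the
    [e]-subdifferentials are bounded above at [y - x] by a constant, hence so is every
    [z + l * phi], which forces [phi (y - x) <= 0].

    Conversely let [phi] be normal to [dom f] at [x] and [z] in the closed convex hull.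
    If [z + l * phi] left the hull, some [u] would separate it from the hull: then
    [phi u > 0] and the hull is bounded above at [u]. The support function at [u] of the
    [e]-subdifferential of [g] at [x] is infinite unless [g] is finite somewhere on the
    open ray from [x] in direction [u]; so every [f_t] is finite at some [x + s_t u], and
    by compactness, upper semicontinuity in [t] and convexity [f] is finite at some
    [x + s u] with [s > 0]. Normality gives [phi u <= 0], a contradiction.

    Both separation arguments rest on a Hahn-Banach theorem for convex subsets of
    [V * R], obtained from a maximal convex cone avoiding the negative half-axis. *)

Set Implicit Arguments.
Unset Strict Implicit.
Unset Printing Implicit Defensive.
Import Order.TTheory GRing.Theory Num.Theory.
Import numFieldNormedType.Exports.
Local Open Scope classical_set_scope.
Local Open Scope ring_scope.

(** * Hahn-Banach for convex subsets of [V * R] *)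

Section HahnBanach.
Context {R : realType} {V : lmodType R}.
Implicit Types (u v w : V) (c d l : R).

Definition convex_rel (D : V -> R -> Prop) := forall v w c d l,
  0 <= l <= 1 -> D v c -> D w d -> D (l *: v + (1 - l) *: w) (l * c + (1 - l) * d).

Definition linear_form (psi : V -> R) :=
  forall l u v, psi (l *: u + v) = l * psi u + psi v.

Let convex_cone (A : set (V * R)) :=
  [/\ forall v w c d, A (v, c) -> A (w, d) -> A (v + w, c + d),
      forall v c l, 0 < l -> A (v, c) -> A (l *: v, l * c) &
      forall c, A (0, c) -> 0 <= c].

(** The cone generated by [D]: [l] carries a point back into [D], so it is the inverse of the usual
    scaling factor. *)
Let hull D : set (V * R) := [set p | exists2 l, 0 < l & D (l *: p.1) (l * p.2)].

Let hull_cone D : convex_rel D -> (forall c, D 0 c -> 0 <= c) ->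
  convex_cone (hull D).
Proof.
move=> cD pD; split.
- move=> v w c d [l /= l0 Dv] [m /= m0 Dw].
  have lm0 : 0 < l + m by rewrite addr_gt0.
  have lm : l + m != 0 by rewrite gt_eqF.
  (* Weights [m / (l + m)] and [l / (l + m)] turn [l *: v] and [m *: w] into a common multiple of
     [v + w]. *)
  exists (l * m / (l + m)) => /=; first by rewrite divr_gt0 ?mulr_gt0.
  have k01 : 0 <= m / (l + m) <= 1.
    by rewrite ler_pdivlMr// ler_pdivrMr// mul0r mul1r lerDr !ltW.
  have := cD _ _ _ _ _ k01 Dv Dw; rewrite !scalerA scalerDr.
  have -> : m / (l + m) * l = l * m / (l + m) by field.
  have -> : (1 - m / (l + m)) * m = l * m / (l + m) by field.
  suff -> : m / (l + m) * (l * c) + (1 - m / (l + m)) * (m * d) =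
    l * m / (l + m) * (c + d) by [].
  by field.
- move=> v c l l0 [m /= m0 Dv]; exists (m / l) => /=; first exact: divr_gt0.
  by rewrite scalerA mulrA -mulrA mulVf ?gt_eqF// mulr1.
- by move=> c [l /= l0]; rewrite scaler0 => /pD; rewrite pmulr_rge0.
Qed.

Let maximal_cone D : D !=set0 -> convex_cone D ->
  exists A, [/\ convex_cone A, D `<=` A &
    forall B, convex_cone B -> A `<=` B -> B `<=` A].
Proof.
move=> [p0 Dp0] cD.
pose P := [set A : set (V * R) | convex_cone A /\ (A !=set0 -> D `<=` A)].
have [F FP totF|A [[cA DA] maxA]] := @Zorn_bigcup _ P.
  split; last first.
    by move=> [p [A FA Ap]] q Dq; exists A => //; apply: (FP A FA).2 => //; exists p.
  split.
  - move=> v w c d [A FA Av] [B FB Bw].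
    have [AB|BA] := totF _ _ FA FB.
      by exists B => //; have [[aB _ _] _] := FP _ FB; apply: aB => //; exact: AB.
    by exists A => //; have [[aA _ _] _] := FP _ FA; apply: aA => //; exact: BA.
  - move=> v c l l0 [A FA Av]; exists A => //.
    by have [[_ sA _] _] := FP _ FA; exact: sA.
  - by move=> c [A FA Ac]; have [[_ _ pA] _] := FP _ FA; exact: pA.
have A0 : A !=set0.
  apply/set0P/negP => /eqP A0; apply: (maxA D); last by split=> // _; exact: subset_refl.
  by rewrite A0; split=> // /(_ _ Dp0).
exists A; split; [by []|exact: DA|move=> B cB AB].
apply: contrapT => nBA; apply: (maxA B) => //; split=> // _.
exact: subset_trans (DA A0) AB.
Qed.

(** [psi v] is the infimum of the fibre over [v] of a maximal cone containing [D]. The absorption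
    hypothesis makes every fibre nonempty, the cone axioms make [psi] sublinear, and maximality
    makes it odd, hence linear. *)
Lemma hahn_banach_convex (D : V -> R -> Prop) : convex_rel D ->
  (forall c, D 0 c -> 0 <= c) ->
  (forall v, exists l c, 0 < l /\ D (l *: v) c) ->
  exists psi, linear_form psi /\ forall v c, D v c -> psi v <= c.
Proof.
move=> cD pD absD.
have DA0 v : exists c, hull D (v, c).
  have [l [c [l0 Dv]]] := absD v; exists (c / l), l => //=.
  by rewrite mulrCA divff ?gt_eqF// mulr1.
have [] := @maximal_cone (hull D) _ (hull_cone cD pD).
  by have [c Dc] := DA0 0; exists (0, c).
move=> A [[addA scaleA posA] DA maxA].
have totA v : exists c, A (v, c) by have [c /DA] := DA0 v; exists c.
(* A point over [- v] bounds the fibre over [v] from below: their sum lies on the vertical axis,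
   where [A] is nonnegative. *)
have lbA v d : A (- v, d) -> lbound [set c | A (v, c)] (- d).
  by move=> Ad c /= Ac; have := addA _ _ _ _ Ac Ad; rewrite subrr => /posA; lra.
pose psi v := inf [set c | A (v, c)].
have psi_le v c : A (v, c) -> psi v <= c.
  move=> Ac; apply: ge_inf => //; have [d Ad] := totA (- v).
  by exists (- d); exact: lbA.
have le_psi v c : (forall d, A (v, d) -> c <= d) -> c <= psi v.
  by move=> cA; apply: lb_le_inf => //; have [d Ad] := totA v; exists d.
(* Under this hypothesis the ray through [(v, c)] can be added to [A], so by maximality
   it already lies in the closure of [A]. *)
have psi_max v c : (forall d, A (- v, d) -> - c <= d) -> psi v <= c.
  move=> cle.
  pose B := [set p : V * R | exists w d l,
    [/\ 0 <= l, A (w, d) & p = (w + l *: v, d + l * c)]].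
  have AB : A `<=` B.
    by move=> [w d] Aw; exists w, d, 0; rewrite scale0r mul0r !addr0.
  have BA : B `<=` A.
    apply: maxA => //; split.
    - move=> _ _ _ _ [w [d [l [l0 Aw [-> ->]]]]] [w' [d' [l' [l'0 Aw' [-> ->]]]]].
      exists (w + w'), (d + d'), (l + l'); split; [exact: addr_ge0|exact: addA|].
      by rewrite scalerDl mulrDl addrACA [in X in (_, X)]addrACA.
    - move=> _ _ m m0 [w [d [l [l0 Aw [-> ->]]]]].
      exists (m *: w), (m * d), (m * l); split; [|exact: scaleA|].
        by rewrite mulr_ge0// ltW.
      by rewrite scalerDr scalerA mulrDr mulrA.
    - move=> c' [w [d [l [l0 Aw [/esym/eqP w0 ->]]]]]; move: l0 w0.
      rewrite addr_eq0 le_eqVlt => /orP[/eqP<-|l0 /eqP w0].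
        by rewrite scale0r oppr0 mul0r addr0 => /eqP w0; apply: posA; rewrite -w0.
      have /cle : A (- v, l^-1 * d).
        have -> : - v = l^-1 *: w.
          by rewrite w0 scalerN scalerA mulVf ?scale1r// gt_eqF.
        by apply: scaleA => //; rewrite invr_gt0.
      by rewrite ler_pdivlMl//; lra.
  (* The origin need not belong to [A], so [(v, c)] is reached only up to an error: a point [(0, d)]
     of [A], scaled by [e / (d + 1)], costs less than [e]. *)
  apply/ler_addgt0Pr => e e0.
  have [d Ad] := totA 0; have d0 := posA _ Ad.
  have Ae : A (0, e / (d + 1) * d).
    by rewrite -(scaler0 _ (e / (d + 1))); apply: scaleA => //; rewrite divr_gt0//; lra.
  have /psi_le/le_trans : A (v, e / (d + 1) * d + c).
    apply: BA; exists 0, (e / (d + 1) * d), 1; split => //.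
    by rewrite add0r scale1r mul1r.
  apply; rewrite addrC lerD2l mulrAC ler_pdivrMr; nra.
have psiD_le u v : psi (u + v) <= psi u + psi v.
  rewrite -lerBlDr; apply/le_psi => c Ac; rewrite lerBlDr -lerBlDl.
  by apply: le_psi => d Ad; rewrite lerBlDl; apply/psi_le/addA.
have psiN v : psi (- v) = - psi v.
  apply/eqP; rewrite eq_le; apply/andP; split.
    by apply: psi_max => d; rewrite !opprK => /psi_le.
  have := psiD_le v (- v); rewrite subrr; have : 0 <= psi 0 by exact: le_psi.
  lra.
have psiD u v : psi (u + v) = psi u + psi v.
  apply/eqP; rewrite eq_le psiD_le/=.
  by have := psiD_le (u + v) (- v); rewrite addrK psiN; lra.
have psiZ_le l v : 0 < l -> psi (l *: v) <= l * psi v.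
  move=> l0; rewrite -ler_pdivrMl//; apply: le_psi => c Ac.
  by rewrite ler_pdivrMl//; apply/psi_le/scaleA.
have psiZ_gt0 l v : 0 < l -> psi (l *: v) = l * psi v.
  move=> l0; apply/eqP; rewrite eq_le psiZ_le//= -ler_pdivlMl//.
  rewrite -[in X in X <= _](scale1r v) -(@mulVf _ l) ?gt_eqF// -scalerA.
  by apply: psiZ_le; rewrite invr_gt0.
have psi0 : psi 0 = 0 by have := psiD 0 0; rewrite addr0; lra.
have psiZ l v : psi (l *: v) = l * psi v.
  have [l0|l0|->] := ltgtP l 0; last by rewrite scale0r mul0r.
    by rewrite -[l]opprK scaleNr psiN psiZ_gt0 ?oppr_gt0//; ring.
  exact: psiZ_gt0.
exists psi; split=> [l u v|v c Dv]; first by rewrite psiD psiZ.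
by apply/psi_le/DA; exists 1; rewrite ?scale1r ?mul1r.
Qed.

End HahnBanach.

(** * Elementary calculus of linear forms *)

Section LinearForm.
Context {R : realType} {V : lmodType R} (psi : V -> R).
Hypothesis lin_psi : linear_form psi.

Lemma linear_form0 : psi 0 = 0.
Proof. by have := lin_psi 1 0 0; rewrite scale1r addr0; lra. Qed.

Lemma linear_formD u v : psi (u + v) = psi u + psi v.
Proof. by have := lin_psi 1 u v; rewrite scale1r mul1r. Qed.

Lemma linear_formZ l v : psi (l *: v) = l * psi v.
Proof. by have := lin_psi l v 0; rewrite linear_form0 !addr0. Qed.

Lemma linear_formN v : psi (- v) = - psi v.
Proof. by rewrite -scaleN1r linear_formZ mulN1r. Qed.

Lemma linear_formB u v : psi (u - v) = psi u - psi v.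
Proof. by rewrite linear_formD linear_formN. Qed.

Lemma linear_form_sum (I : finType) (a : I -> R) (u : I -> V) :
  psi (\sum_i a i *: u i) = \sum_i a i * psi (u i).
Proof.
rewrite (big_morph psi linear_formD linear_form0).
by apply: eq_bigr => i _; rewrite linear_formZ.
Qed.

End LinearForm.

(** * Weak* closure, half-spaces and separation in the dual *)

Lemma closure_ptws {R : realType} {X : topologicalType} (C : set (X -> R)) (phi : X -> R) :
  (forall (s : seq X) (d : R), 0 < d ->
    exists2 psi, C psi & forall u, u \in s -> `|phi u - psi u| < d) ->
  @closure {ptws X -> R} C phi.
Proof.
move=> Cphi; rewrite closureEcvg.
(* The elements of [C] that are [d]-close to [phi] on a finite list form a filter base converging
   pointwise to [phi]. *)
pose B (p : seq X * R) := [set psi | C psi /\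
  forall u, u \in p.1 -> `|phi u - psi u| < p.2].
pose F := filter_from [set p : seq X * R | 0 < p.2] B.
have FF : Filter F.
  apply: filter_from_filter; first by exists ([::], 1) => /=.
  move=> [s d] [s' d'] /= d0 d'0; exists (s ++ s', Num.min d d').
    by rewrite /= lt_min d0.
  move=> psi [Cpsi /= Hpsi]; split; split=> //= u us.
    by have := Hpsi u; rewrite mem_cat us lt_min => /(_ isT)/andP[].
  by have := Hpsi u; rewrite mem_cat us orbT lt_min => /(_ isT)/andP[].
exists F.
  apply: filter_from_proper => // -[s d] /= d0.
  by have [psi Cpsi Hpsi] := Cphi s d d0; exists psi.
split; last by move=> A CA; exists ([::], 1) => //= psi [Cpsi _]; exact: CA.
apply: (pointwise_cvgP phi FF).2 => u; apply/cvgrPdist_lt => e e0.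
by exists ([:: u], e) => //= psi [_ /(_ u)]; apply; rewrite mem_head.
Qed.

Section WeakStar.
Context {R : realType} {X : tvsType R}.
Implicit Types (C : set (X -> R)) (phi psi : X -> R) (u v : X).

Lemma linear_form_dual phi : dual phi -> linear_form phi.
Proof. by case. Qed.

(** A weak* neighbourhood of [phi] missing [C] involves only finitely many points [s]. Evaluation at
    [s] reduces the separation to row vectors, where a linear form is evaluation at a linear
    combination of [s]; this combination is [u]. *)
Lemma wstar_separation C phi : wstar_closed C -> dual_convex C -> dual phi ->
  ~ C phi -> exists u, forall psi, C psi -> psi u <= phi u - 1.
Proof.
move=> [Cdual clC] cvxC dphi nCphi.
have [[psi0 Cpsi0]|C0] := pselect (C !=set0); last first.
  by exists 0 => psi Cpsi; exfalso; apply: C0; exists psi.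
have [s [d [d0 sd]]] : exists (s : seq X) (d : R), 0 < d /\
    forall psi, C psi -> exists2 u, u \in s & d <= `|phi u - psi u|.
  apply: contrapT => nsd; apply: nCphi; apply: clC; split=> //.
  apply: closure_ptws => s d d0; apply: contrapT => nC; apply: nsd.
  exists s, d; split=> // psi Cpsi; apply: contrapT => nu; apply: nC.
  exists psi => // u us; rewrite ltNge; apply/negP => du; apply: nu.
  by exists u.
pose n := size s; pose e (i : 'I_n) : X := s`_i.
(* At height [c] the image of [C - phi] is fattened by the sup-norm radius [d * (c + 1)]. At height
   [-1] it is the image itself, whence the gap 1; below height 0 the radius is less than [d], too
   small to reach the origin. *)
pose D (v : 'rV[R]_n) (c : R) := exists2 psi, C psi &
  forall i, `|v 0 i - (psi (e i) - phi (e i))| <= d * (c + 1).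
have [|||c [linc cD]] := @hahn_banach_convex R _ D.
- move=> v w c c' l l01 [psi Cpsi Hpsi] [psi' Cpsi' Hpsi'].
  exists (fun u => l * psi u + (1 - l) * psi' u); first exact: cvxC.
  move=> i; rewrite !mxE.
  have -> : l * v 0 i + (1 - l) * w 0 i -
     (l * psi (e i) + (1 - l) * psi' (e i) - phi (e i)) =
     l * (v 0 i - (psi (e i) - phi (e i))) +
     (1 - l) * (w 0 i - (psi' (e i) - phi (e i))) by ring.
  have /andP[l0 l1] := l01.
  apply: le_trans (ler_normD _ _) _; rewrite !normrM (ger0_norm l0).
  rewrite (@ger0_norm _ (1 - l)) ?subr_ge0//.
  have := ler_wpM2l l0 (Hpsi i).
  have := @ler_wpM2l _ (1 - l) _ _ _ (Hpsi' i); rewrite subr_ge0 => /(_ l1).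
  lra.
- move=> c [psi Cpsi Hpsi]; have [u us du] := sd _ Cpsi.
  have us_lt : (index u s < n)%N by rewrite index_mem.
  have := Hpsi (Ordinal us_lt); rewrite mxE sub0r normrN /e /= nth_index// distrC.
  by move=> /(le_trans du); rewrite -subr_ge0; nra.
- move=> v.
  pose M := \sum_i `|v 0 i - (psi0 (e i) - phi (e i))|.
  exists 1, (M / d); split=> //; exists psi0 => // i; rewrite scale1r.
  rewrite mulrDr mulr1 mulrCA divff ?gt_eqF// mulr1.
  rewrite (@le_trans _ _ M)//; last by rewrite lerDl ltW.
  by rewrite /M (bigD1 i)//= lerDl sumr_ge0.
pose u := \sum_i c (delta_mx 0 i) *: e i.
have cE (v : 'rV_n) : c v = \sum_i c (delta_mx 0 i) * v 0 i.
  rewrite {1}(row_sum_delta v) linear_form_sum//.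
  by apply: eq_bigr => i _; rewrite mulrC.
exists u => psi Cpsi; pose v : 'rV_n := \row_i (psi (e i) - phi (e i)).
have : c v <= -1.
  by apply: cD; exists psi => // i; rewrite mxE subrr normr0 addNr mulr0.
rewrite cE.
suff -> : \sum_i c (delta_mx 0 i) * v 0 i = psi u - phi u by lra.
rewrite /u (linear_form_sum (linear_form_dual (Cdual _ Cpsi))).
rewrite (linear_form_sum (linear_form_dual dphi)) -sumrB.
by apply: eq_bigr => i _; rewrite mxE; ring.
Qed.

Lemma sub_clco (A : set (X -> R)) : A `<=` clco A.
Proof. by move=> phi Aphi C _ _; apply. Qed.

Lemma wstar_closed_halfspace u (M : R) :
  wstar_closed [set phi | dual phi /\ phi u <= M].
Proof.
split=> [phi []//|phi [dphi clphi]]; split=> //.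
have : closed [set phi : {ptws X -> R} | phi u <= M].
  apply: (@closed_comp {ptws X -> R} R (fun phi => phi u) [set x | x <= M]).
    move=> ? _; exact: proj_continuous.
  exact: closed_le.
by apply; apply: closureS clphi => psi [].
Qed.

Lemma dual_convex_comb phi psi (k l : R) : dual phi -> dual psi ->
  dual (fun v => k * phi v + l * psi v).
Proof.
move=> [lphi cphi] [lpsi cpsi]; split=> [a u v|v].
  by rewrite lphi lpsi; ring.
exact: cvgD (cvgM (cvg_cst k) (cphi v)) (cvgM (cvg_cst l) (cpsi v)).
Qed.

(** The half-space at [u] is one of the weak* closed convex sets intersected in [clco A]. *)
Lemma clco_le (A : set (X -> R)) u (M : R) : A `<=` dual ->
  (forall phi, A phi -> phi u <= M) ->
  forall phi, clco A phi -> dual phi /\ phi u <= M.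
Proof.
move=> Adual AM phi clphi; apply: (clphi [set psi | dual psi /\ psi u <= M]).
- exact: wstar_closed_halfspace.
- move=> psi psi' l [d le] [d' le'] /andP[l0 l1]; split.
    exact: dual_convex_comb.
  have := ler_wpM2l l0 le.
  have := @ler_wpM2l _ (1 - l) _ _ _ le'; rewrite subr_ge0 => /(_ l1); lra.
- by move=> psi Apsi; split; [exact: Adual|exact: AM].
Qed.

Lemma clco_dual (A : set (X -> R)) : A `<=` dual -> clco A `<=` dual.
Proof.
(* The half-space at the point 0 with bound 0 is the whole dual. *)
move=> Adual phi Aphi; suff [] : dual phi /\ phi 0 <= 0 by [].
apply: clco_le Aphi => // psi /Adual/linear_form_dual/linear_form0 ->.
exact: lexx.
Qed.

Lemma clco_separation (A : set (X -> R)) phi : dual phi -> ~ clco A phi ->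
  exists u, forall psi, clco A psi -> psi u <= phi u - 1.
Proof.
move=> dphi nA.
have [C [clC cvxC AC nC]] : exists C,
    [/\ wstar_closed C, dual_convex C, A `<=` C & ~ C phi].
  apply: contrapT => nC; apply: nA => C clC cvxC AC.
  by apply: contrapT => nCphi; apply: nC; exists C.
have [u Cu] := wstar_separation clC cvxC dphi nC.
by exists u => psi /(_ C clC cvxC AC); exact: Cu.
Qed.

End WeakStar.

(** * Continuity and semicontinuity in a locally convex space *)

Section LocallyConvex.
Context {R : realType} {X : tvsType R}.
Implicit Types (u v w x y : X) (g : X -> \bar R).

Lemma cvg_tvsZ {T : Type} (F : set_system T) (k : T -> R) (h : T -> X) (l : R) v {FF : Filter F} :
  k @ F --> l -> h @ F --> v -> k t *: h t @[t --> F] --> l *: v.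
Proof.
move=> kl hv.
apply: (@cvg_comp _ _ _ (fun t => (k t : R^o, h t)) (fun z : R^o * X => z.1 *: z.2)
  F (nbhs ((l : R^o), v))).
  by apply: (@cvg_pair _ _ _ _ (nbhs (l : R^o))).
exact: (@scale_continuous R X (l, v)).
Qed.

Lemma cvg_tvsD {T : Type} (F : set_system T) (h h' : T -> X) v v'
    {FF : Filter F} :
  h @ F --> v -> h' @ F --> v' -> h t + h' t @[t --> F] --> v + v'.
Proof.
move=> hv hv'.
apply: (@cvg_comp _ _ _ (fun t => (h t, h' t)) (fun z : X * X => z.1 + z.2)
  F (nbhs (v, v'))).
  by apply: (@cvg_pair _ _ _ _ (nbhs v)).
exact: (@add_continuous X (v, v')).
Qed.

Lemma nbhs0_convex (N : set X) : nbhs 0 N -> exists U : set X,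
  [/\ nbhs 0 U, U `<=` N &
      forall v w (l : R), 0 <= l <= 1 -> U v -> U w -> U (l *: v + (1 - l) *: w)].
Proof.
have [B cB [Bop Bbase]] := @locally_convex R X.
move=> /(Bbase 0) [U /= [BU U0] UN]; exists U; split=> //.
  exact/open_nbhs_nbhs/(conj (Bop _ BU)).
move=> v w l /andP[l0 l1] Uv Uw.
have := cB U (mem_set BU) v w (Itv01 l0 l1) (mem_set Uv) (mem_set Uw).
by move/set_mem.
Qed.

(** A one-sided bound suffices because it is applied to both [k *: (v - y)] and [k *: (y - v)]; the
    factor [k] is chosen so that [M < k * e]. *)
Lemma linear_form_continuous (psi : X -> R) (U : set X) (M : R) :
  linear_form psi -> nbhs 0 U -> (forall w, U w -> - M <= psi w) ->
  continuous psi.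
Proof.
move=> lpsi U0 UM v; apply/cvgrPdist_lt => e e0.
pose k := (`|M| + 1) / e.
have k0 : 0 < k by rewrite divr_gt0// ltr_wpDl.
have cvgk (h : X -> X) :
    h y @[y --> v] --> (0 : X) -> \forall y \near v, U (k *: h y).
  by move=> /(cvg_tvsZ (cvg_cst k)); rewrite scaler0 => /(_ _ U0).
have sub0 : (y - v) @[y --> v] --> (0 : X).
  by rewrite -(subrr v); apply: cvg_tvsD; [exact: cvg_id|exact: cvg_cst].
have sub0' : (v - y) @[y --> v] --> (0 : X).
  rewrite -(subrr v); apply: cvg_tvsD; first exact: cvg_cst.
  exact: opp_continuous.
near=> y.
have /UM : U (k *: (v - y)) by near: y; exact: cvgk.
have /UM : U (k *: (y - v)) by near: y; exact: cvgk.
rewrite !(linear_formZ lpsi) !(linear_formB lpsi) => h1 h2.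
have : k * `|psi v - psi y| <= M.
  by case: (ger0P (psi v - psi y)) => _; nra.
have kE : k * e = `|M| + 1 by rewrite /k divfK// gt_eqF.
move=> le_M; suff : k * `|psi v - psi y| < k * e by rewrite ltr_pM2l.
rewrite kE; apply: le_lt_trans le_M _.
by rewrite (le_lt_trans (ler_norm M))// ltrDl.
Unshelve. all: by end_near. Qed.

(** Compactness of [[0, 1]] makes the neighbourhoods from lower semicontinuity uniform in [s]. The
    resulting tube around the segment gives the Hahn-Banach argument an absorbing set. *)
Lemma lsc_segment g x u (a K : R) : lower_semicontinuous g ->
  (forall s : R, 0 <= s <= 1 -> ((a + s * K)%:E < g (x + s *: u)%R)%E) ->
  \forall w \near (0 : X), forall s : R, 0 <= s <= 1 ->
    ((a + s * K)%:E < g (x + s *: u + w)%R)%E.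
Proof.
move=> lg ag.
pose P (w : X) (s : R) := ((a + s * K)%:E < g (x + s *: u + w)%R)%E.
suff : \forall w \near (0 : X), [set` `[(0 : R), 1]] `<=` P w.
  by apply: filterS => w Pw s s01; apply: Pw; rewrite /= in_itv.
have /compact_near_coveringP := @segment_compact R 0 1.
apply => s /=; rewrite in_itv/= => /ag agE.
(* The intermediate level [b] leaves room for moving both the affine function and the argument of
   [g]. *)
have [b ab bg] : exists2 b : R, a + s * K < b & (b%:E < g (x + s *: u)%R)%E.
  case: (g (x + s *: u)) agE => [r| |//]; last first.
    by exists (a + s * K + 1); [rewrite ltrDl|exact: ltry].
  rewrite lte_fin => ar; exists ((a + s * K + r) / 2); rewrite ?lte_fin; lra.
have [W Wx Wg] := lg _ _ bg.
have cont : z.2 + (x + z.1 *: u) @[z --> (nbhs s, nbhs (0 : X))] --> 0 + (x + s *: u).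
  apply: cvg_tvsD; first exact: cvg_snd.
  apply: cvg_tvsD; first exact: cvg_cst.
  apply: cvg_tvsZ; last exact: cvg_cst.
  exact: cvg_fst.
rewrite add0r in cont.
have cvga : a + z.1 * K @[z --> (nbhs s, nbhs (0 : X))] --> a + s * K.
  apply: cvgD; first exact: cvg_cst.
  by apply: cvgM; [exact: cvg_fst|exact: cvg_cst].
have FF : Filter (filter_prod (nbhs s) (nbhs (0 : X))) by exact: filter_prod_filter.
have nearb : \forall z \near (nbhs s, nbhs (0 : X)), a + z.1 * K < b.
  exact: cvgr_lt cvga _ ab.
apply: filterS (filterI nearb (cont _ Wx)).
move=> [t w] [/= tb Ww]; rewrite /P.
by apply: lt_trans (Wg _ _); [rewrite lte_fin|rewrite addrC].
Qed.

End LocallyConvex.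

(** * Nonemptiness and support function of the [e]-subdifferential *)

Section EpsSubdifferential.
Context {R : realType} {X : tvsType R}.
Implicit Types (u v w x y : X) (g : X -> \bar R).

Lemma convex_efun_le g x y (q q' l : R) : convex_efun g -> 0 <= l <= 1 ->
  (g x <= q%:E)%E -> (g y <= q'%:E)%E ->
  (g (l *: x + (1 - l) *: y)%R <= (l * q + (1 - l) * q')%:E)%E.
Proof.
move=> cg l01 gx gy; apply: le_trans (cg _ _ _ l01) _; case/andP: l01 => l0 l1.
by rewrite (EFinD (l * q)) !EFinM leeD// lee_wpmul2l// lee_fin ?subr_ge0.
Qed.

(* A non-vertical hyperplane strictly separating the epigraph of [g] from the segment
   with endpoints [(x, r - e)] and [(x + u, r - e + K)] is the graph of
   [y |-> r + phi (y - x) - c] with [c < e]. *)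
Lemma eps_subdiff_segment g x u (r e K : R) :
  convex_efun g -> lower_semicontinuous g -> (forall y, g y != -oo%E) ->
  g x = r%:E ->
  (forall s : R, 0 <= s <= 1 -> ((r - e + s * K)%:E < g (x + s *: u)%R)%E) ->
  exists2 phi, eps_subdiff e g x phi & K - e <= phi u.
Proof.
move=> cg lg gNy gx seg.
have [U [U0 Ug cU]] := nbhs0_convex (lsc_segment lg seg).
(* The epigraph of [g] minus the segment thickened by [U]: the choice of [U] keeps it nonnegative
   over 0, and the thickening makes it absorbing. *)
pose D v c := exists y s w q, [/\ 0 <= s <= 1, U w, (g y <= q%:E)%E,
  v = y - (x + s *: u + w) & c = q - (r - e + s * K)].
have Uz : U 0 by exact: nbhs_singleton.
have gxr : (g x <= r%:E)%E by rewrite gx.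
have [|||psi [lpsi psiD]] := @hahn_banach_convex R X D.
- move=> _ _ _ _ l l01 [y [s [w [q [s01 Uw gy -> ->]]]]]
    [y' [s' [w' [q' [s'01 Uw' gy' -> ->]]]]].
  exists (l *: y + (1 - l) *: y'), (l * s + (1 - l) * s'),
    (l *: w + (1 - l) *: w'), (l * q + (1 - l) * q'); split.
  + by case/andP: l01 s01 s'01 => ? ? /andP[? ?] /andP[? ?]; nra.
  + exact: cU.
  + exact: convex_efun_le.
  + have xE : x = l *: x + (1 - l) *: x by rewrite -scalerDl addrC subrK scale1r.
    have -> : x + (l * s + (1 - l) * s') *: u + (l *: w + (1 - l) *: w') =
        l *: (x + s *: u + w) + (1 - l) *: (x + s' *: u + w').
      rewrite {1}xE (scalerDl u (l * s)) -!scalerA !scalerDr.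
      by rewrite [RHS]addrACA; congr (_ + _); exact: addrACA.
    by rewrite !scalerBr opprD [RHS]addrACA.
  + by ring.
- move=> c [y [s [w [q [s01 Uw gy /esym/eqP]]]]].
  rewrite subr_eq0 => /eqP yE ->; rewrite yE in gy.
  by rewrite subr_ge0 -lee_fin ltW// (lt_le_trans (Ug w Uw s s01)).
- move=> v.
  have cvg0 : l *: (- v) @[l --> 0^'+] --> (0 : X).
    rewrite -(scale0r (- v)); apply: cvg_tvsZ; last exact: cvg_cst.
    exact: cvg_at_right_filter.
  near (0 : R)^'+ => l.
  exists l, e; split; first by near: l; exact: nbhs_right_gt.
  exists x, 0, (l *: - v), r; split => //.
  + by rewrite lexx ler01.
  + by near: l; exact: cvg0.
  + by rewrite scale0r addr0 opprD addrA subrr sub0r scalerN opprK.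
  + by rewrite mul0r; ring.
(* Three choices in [D] are used: [y = x], [s = 1], [w = 0] bounds [psi u] below; [y = x], [s = 0]
   with [w] in [U] gives continuity; [s = 0], [w = 0] with [y] free gives the subgradient
   inequality. *)
exists psi; last first.
  have := psiD (- u) (e - K); rewrite (linear_formN lpsi) => psiN.
  have : - psi u <= e - K; last by lra.
  apply: psiN.
  exists x, 1, 0, r; split => //; rewrite ?ler01 ?lexx//.
    by rewrite scale1r addr0 opprD addrA subrr sub0r.
  by ring.
split; [split|split].
- exact: lpsi.
- apply: (linear_form_continuous (M := e) lpsi U0) => w Uw.
  have : psi (- w) <= e.
    apply: psiD; exists x, 0, w, r; split => //; rewrite ?ler01 ?lexx//.
      by rewrite scale0r addr0 opprD addrA subrr sub0r.
    by ring.
  by rewrite (linear_formN lpsi) lerNl.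
- by rewrite gx.
- move=> y; rewrite gx; case gyE : (g y) => [q| |].
  + have : psi (y - x) <= q - (r - e).
      apply: psiD; exists y, 0, 0, q; split => //; rewrite ?ler01 ?lexx ?gyE//.
        by rewrite scale0r !addr0.
      by ring.
    by rewrite lee_fin; lra.
  + by rewrite leey.
  + by have := gNy y; rewrite gyE eqxx.
Unshelve. all: by end_near. Qed.

Lemma eps_subdiff_neq0 g x (r e : R) : convex_efun g -> lower_semicontinuous g ->
  (forall y, g y != -oo%E) -> g x = r%:E -> 0 < e -> eps_subdiff e g x !=set0.
Proof.
move=> cg lg gNy gx e0.
(* The segment degenerates to the point [(x, r - e)]. *)
have [|phi ephi _] := @eps_subdiff_segment g x 0 r e 0 cg lg gNy gx.
  by move=> s _; rewrite mulr0 scaler0 !addr0 gx lte_fin; lra.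
by exists phi.
Qed.

(** If [g] is infinite on the open ray, segments of every slope [K] stay below its graph;
    [K = M + e + 1] then yields [phi u >= M + 1]. *)
Lemma eps_subdiff_bounded g x u (r e M : R) :
  convex_efun g -> lower_semicontinuous g -> (forall y, g y != -oo%E) ->
  g x = r%:E -> 0 < e -> (forall phi, eps_subdiff e g x phi -> phi u <= M) ->
  exists2 s : R, 0 < s & (g (x + s *: u)%R < +oo)%E.
Proof.
move=> cg lg gNy gx e0 phiM; apply: contrapT => goo.
have [|phi /phiM] := @eps_subdiff_segment g x u r e (M + e + 1) cg lg gNy gx.
  move=> s /andP[]; rewrite le_eqVlt => /orP[/eqP<- _|s0 _].
    by rewrite mul0r scale0r !addr0 gx lte_fin; lra.
  have [/(lt_le_trans (ltry _))//|gs] := leP +oo%E (g (x + s *: u)).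
  by exfalso; apply: goo; exists s.
by lra.
Qed.

End EpsSubdifferential.

(** * Positive multiples of functions in [Gamma0] *)

Section Scaling.
Context {R : realType} {X : tvsType R} (g : X -> \bar R) (k : R).
Hypotheses (Gg : Gamma0 g) (k0 : 0 < k).

Lemma scale_neqNy y : (k%:E * g y != -oo)%E.
Proof.
have [[gNy _] _ _] := Gg; have := gNy y.
by case: (g y) => [q| |]//= _; rewrite gt0_muley ?lte_fin.
Qed.

Lemma scale_convex_efun : convex_efun (fun y => k%:E * g y)%E.
Proof.
move=> u v l l01; have [[gNy _] cg _] := Gg.
(* Distributing [k] over the sum requires excluding [+oo - oo]; for [l' = 0] the product is 0 even
   where [g y] is infinite. *)
have gM (l' : R) y : 0 <= l' -> (-oo < l'%:E * g y)%E.
  rewrite le_eqVlt => /orP[/eqP<-|l'0]; first by rewrite mul0e ltNye.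
  have := gNy y; case: (g y) => [q| |]//= _; first by rewrite ltNyr.
  by rewrite gt0_muley ?lte_fin.
have /andP[l0 l1] := l01.
rewrite (muleCA l%:E) (muleCA (1 - l)%:E) -muleDr//; last first.
  by rewrite ltninfty_adde_def// inE gM// subr_ge0.
by apply: lee_wpmul2l; [rewrite lee_fin ltW|exact: cg].
Qed.

Lemma scale_lower_semicontinuous : lower_semicontinuous (fun y => k%:E * g y)%E.
Proof.
have [_ _ lg] := Gg => y a; rewrite -lte_pdivrMl// -EFinM => /lg[V Vy Vg].
by exists V => // w /Vg; rewrite EFinM lte_pdivrMl.
Qed.

Lemma scale_lty y : (k%:E * g y < +oo)%E = (g y < +oo)%E.
Proof.
case: (g y) => [q| |]; first by rewrite -EFinM !ltry.
  by rewrite gt0_muley ?lte_fin.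
by rewrite gt0_muleNy ?lte_fin.
Qed.

End Scaling.

(** * Directions in which the supremum stays finite *)

Section Supremum.
Context {R : realType} {X : tvsType R} {T : topologicalType}.
Variable fam : T -> X -> \bar R.

Lemma le_supf t y : (fam t y <= supf fam y)%E.
Proof. by apply: ereal_sup_ubound; exists t. Qed.

(** Nonnegativity of [b] ensures that weights in [(0, 1]] do not increase the bound. *)
Lemma lty_le_fin (a : \bar R) : (a < +oo)%E -> exists2 b : R, 0 <= b & (a <= b%:E)%E.
Proof.
case: a => [q _| //|_]; last by exists 0; rewrite ?leNye.
by exists (Num.max q 0); rewrite ?lee_fin le_max lexx ?orbT.
Qed.

Lemma gtNy_ge_fin (a : \bar R) : (-oo < a)%E -> exists b : R, (b%:E <= a)%E.
Proof. by case: a => [q _|_|//]; [exists q|exists 0; rewrite leey]. Qed.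

Lemma supf_dom_direction x u : SH fam -> (forall t, convex_efun (fam t)) ->
  edom (supf fam) x ->
  (forall t, exists2 s : R, 0 < s & (fam t (x + s *: u)%R < +oo)%E) ->
  exists2 s : R, 0 < s & edom (supf fam) (x + s *: u).
Proof.
move=> [cT _ usc] cfam xdom tdom.
have [b _ xb] := lty_le_fin xdom.
(* One index governs both the step and the bound. Near each [t], semicontinuity bounds the family at
   [x + s *: u], and convexity between this point and [x] gives [P n] for all large [n]; compactness
   makes [n] uniform. *)
pose P (n : nat) t := (fam t (x + n.+1%:R^-1 *: u)%R <= n%:R%:E)%E.
have : \forall n \near \oo, [set: T] `<=` P n.
  apply: (compact_near_coveringP _).1 => // t _.
  have [s s0 sdom] := tdom t; have [c _ sc] := lty_le_fin sdom.
  have [|V Vt Vc] := usc (x + s *: u) t (c + 1).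
    by rewrite (le_lt_trans sc)// lte_fin ltrDl.
  have nearn : \forall n \near \oo,
      [/\ n.+1%:R^-1 < s, b <= n%:R & c + 1 <= n%:R].
    near=> n; split; last 2 first.
    - by near: n; exact: nbhs_infty_ger.
    - by near: n; exact: nbhs_infty_ger.
    - by near: n; exact: (near_infty_natSinv_lt (PosNum s0)).
  exists (V, [set n : nat | [/\ n.+1%:R^-1 < s, b <= n%:R & c + 1 <= n%:R]]) => //.
  move=> [t' n] [/= Vt' [ns bn cn]].
  rewrite /P /=; pose l := n.+1%:R^-1 / s.
  have l01 : 0 <= l <= 1.
    by rewrite divr_ge0 ?(ltW s0)//= ler_pdivrMr// mul1r ltW.
  have -> : (fam t' (x + n.+1%:R^-1 *: u)%R <= n%:R%:E)%E =
      (fam t' (l *: (x + s *: u) + (1 - l) *: x)%R <= (l * n%:R + (1 - l) * n%:R)%:E)%E.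
    rewrite -mulrDl (addrC l) subrK mul1r; congr (fam t' _ <= _)%E.
    rewrite scalerDr addrAC -scalerDl (addrC l) subrK scale1r scalerA.
    by rewrite /l divfK// gt_eqF.
  apply: convex_efun_le => //.
    by apply: le_trans (ltW (Vc _ Vt')) _; rewrite lee_fin.
  by apply: le_trans (le_supf t' x) (le_trans xb _); rewrite lee_fin.
move=> [n _ /(_ n (leqnn n)) nP]; exists n.+1%:R^-1 => //.
rewrite /edom /=; apply: (@le_lt_trans _ _ n%:R%:E); last exact: ltry.
by apply: ge_ereal_sup => _ [t _ <-]; exact: nP.
Unshelve. all: by end_near. Qed.

End Supremum.

(** * The two inclusions between recession cone and normal cone *)

Section Inclusions.
Context {R : realType} {X : tvsType R} {T : topologicalType}.
Variables (fam : T -> X -> \bar R) (eps : T -> R) (x : X).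
Hypotheses (Gfam : forall t, Gamma0 (fam t)) (xdom : edom (supf fam) x).
Hypothesis eps01 : forall t, 0 < eps t <= 1.

Let g t y := ((eps t)%:E * fam t y)%E.
Let A (e : R) := \bigcup_(t in [set: T]) eps_subdiff e (g t) x.

Lemma bigcup_eps_subdiff_dual e : A e `<=` dual.
Proof. by move=> phi [t _ []]. Qed.

Lemma recession_sub_normal_cone e : (-oo < ereal_inf [set g t x | t in [set: T]])%E ->
  recession (clco (A e)) `<=` normal_cone (edom (supf fam)) x.
Proof.
move=> /gtNy_ge_fin[m mg] y [dy [z _ zy]]; split=> // w /lty_le_fin[b b0 wb].
(* Here [m] bounds every [g t x] from below, and [eps t <= 1] with [0 <= b] bounds every [g t w] by
   [b]. *)
have Aw phi : A e phi -> phi (w - x) <= b - m + e.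
  move=> [t _ [_ [/fineK gx /(_ w)]]]; rewrite -gx => gw.
  have /(le_trans mg) : (ereal_inf [set g t x | t in [set: T]] <= g t x)%E.
    by apply: ereal_inf_lbound; exists t.
  rewrite -gx lee_fin => mgx.
  have gwb : (g t w <= b%:E)%E.
    have [t0 t1] := andP (eps01 t).
    apply: (@le_trans _ _ ((eps t)%:E * b%:E)%E).
      apply: lee_wpmul2l; first by rewrite lee_fin ltW.
      exact: le_trans (le_supf fam t w) wb.
    by rewrite -EFinM lee_fin ler_piMl.
  by move: (le_trans gw gwb); rewrite lee_fin; lra.
rewrite leNgt; apply/negP => y0.
(* With this [l], the value of [z + l * y] at [w - x] exceeds [b - m + e]. *)
pose l := (`|b - m + e - z (w - x)| + 1) / y (w - x).
have l0 : 0 <= l by rewrite divr_ge0// ltW.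
have [_] := clco_le (@bigcup_eps_subdiff_dual e) Aw (zy l l0).
rewrite /l divfK ?gt_eqF//.
by have := ler_norm (b - m + e - z (w - x)); lra.
Qed.

Lemma normal_cone_sub_recession e : [set: T] !=set0 -> SH fam -> 0 < e ->
  normal_cone (edom (supf fam)) x `<=` recession (clco (A e)).
Proof.
move=> [t0 _] SHfam e0 y [dy ny]; split=> //.
have gx t : exists r, g t x = r%:E.
  have [t1 _] := andP (eps01 t).
  have := scale_neqNy (Gfam t) t1 x; have := scale_lty (fam t) t1 x.
  rewrite (le_lt_trans (le_supf fam t x) xdom) /g.
  by case: ((eps t)%:E * fam t x)%E => [r| |]//; exists r.
have gt_props t := (scale_convex_efun (Gfam t) (andP (eps01 t)).1,
  scale_lower_semicontinuous (Gfam t) (andP (eps01 t)).1,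
  scale_neqNy (Gfam t) (andP (eps01 t)).1).
have [z Az] : clco (A e) !=set0.
  have [r gr] := gx t0; have [[cg lg] gNy] := gt_props t0.
  have [phi ephi] := eps_subdiff_neq0 cg lg gNy gr e0.
  by exists phi; apply: sub_clco; exists t0.
exists z => // l l0; apply: contrapT => nA.
have dz : dual z by exact: clco_dual (@bigcup_eps_subdiff_dual e) _ Az.
have dzy : dual (fun v => z v + l * y v).
  suff <- : (fun v => 1 * z v + l * y v) = (fun v => z v + l * y v).
    exact: dual_convex_comb.
  by apply/funext => v; rewrite mul1r.
have [u sep] := clco_separation dzy nA.
(* Separation applied to [z] itself gives [1 <= l * y u], with [l >= 0]. *)
have yu : 0 < y u by have := sep _ Az; rewrite /=; nra.
have [s s0] : exists2 s : R, 0 < s & edom (supf fam) (x + s *: u).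
  apply: (supf_dom_direction SHfam _ xdom) => t; first by have [] := Gfam t.
   have [r gr] := gx t; have [[cg lg] gNy] := gt_props t.
  have [|s s0] := eps_subdiff_bounded (u := u) (M := z u + l * y u - 1) cg lg gNy gr e0.
    by move=> phi ephi; apply: sep; apply: sub_clco; exists t.
  by rewrite /g (scale_lty _ (andP (eps01 t)).1); exists s.
move=> /ny; rewrite addrC addKr (linear_formZ (linear_form_dual dy)).
by rewrite leNgt mulr_gt0.
Qed.

End Inclusions.

Unset Implicit Arguments.

Theorem theorem1 (R : realType) (X : tvsType R) (T : topologicalType)
    (fam : T -> X -> \bar R) (eps : T -> R) (x : X) :
  hausdorff_space X ->
  [set: T] !=set0 ->
  (forall t, Gamma0 (fam t)) ->
  edom (supf fam) x ->
  (forall t, 0 < eps t <= 1) ->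
  (-oo < ereal_inf [set (eps t)%:E * fam t x | t in [set: T]])%E ->
  (forall e : R, 0 < e ->
     recession (clco (\bigcup_(t in [set: T])
                  eps_subdiff e (fun y => ((eps t)%:E * fam t y)%E) x))
     `<=` normal_cone (edom (supf fam)) x)
  /\
  (SH fam -> forall e : R, 0 < e ->
     normal_cone (edom (supf fam)) x =
     recession (clco (\bigcup_(t in [set: T])
                  eps_subdiff e (fun y => ((eps t)%:E * fam t y)%E) x))).
Proof.
move=> _ T0 Gfam xdom eps01 m; split=> [e _|SHfam e e0].
  exact: recession_sub_normal_cone.
apply/seteqP; split; last exact: recession_sub_normal_cone.
exact: normal_cone_sub_recession.
Qed.
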